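(* Let $G=(U,W,E)$ be a connected bipartite graph with bipartition classes $U,W$, where $|U|=a$ and $|W|=b$. For $\alpha\in[0,1]$, $$\lambda_1(B_\alpha(G))\le f_\alpha(a,b),$$ with equality if and only if $G\cong K_{a,b}$.
   Context: All graphs are simple and undirected, with a finite vertex set. $A(G)$ is the adjacency matrix, $D(G)$ the diagonal matrix of vertex degrees, and $L(G)=D(G)-A(G)$ the Laplacian matrix of $G$. For $\alpha\in[0,1]$, $B_\alpha(G):=\alpha A(G)+(1-\alpha)L(G)$. $\lambda_1(S)$ denotes the largest eigenvalue of a real symmetric matrix $S$. $K_{a,b}$ is the complete bipartite graph with parts of sizes $a$ and $b$. For $\alpha\in[0,1]$ and non-negative integers $a,b$, $$f_\alpha(a,b)=\frac{(1-\alpha)(a+b)+\sqrt{(1-\alpha)^2(a-b)^2+4(2\alpha-1)^2ab}}{2}.$$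
   Formalization: ''Equality only if G ≅ K_{a,b}'' is stated for α ≠ 1/2, as it fails at α = 1/2 (path P_4, a = b = 2: both sides equal 1); the classes U, W are taken non-empty, since for K_1 = K_{1,0} and α < 1 equality fails. *)

(* Defs.v *)
From HB Require Import structures.
From mathcomp Require Import all_boot all_order all_algebra.
From mathcomp Require Import classical_sets reals.

Set Implicit Arguments.
Unset Strict Implicit.
Unset Printing Implicit Defensive.

Import Order.TTheory GRing.Theory Num.Theory.

Local Open Scope ring_scope.

Record sgraph := SGraph {
  vertex :> finType;
  adj : rel vertex;
  adj_sym : symmetric adj;
  adj_irrefl : irreflexive adj
}.

Definition degree (G : sgraph) (x : G) : nat := #|[set y | adj x y]|.

(* A graph with no vertices is excluded here by the non-emptiness clauses of
   [bipartition]. *)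
Definition connected (G : sgraph) : Prop := forall x y : G, connect (@adj G) x y.

(* The two classes of a bipartition are non-empty. *)
Definition bipartition (G : sgraph) (U W : {set G}) : Prop :=
  [/\ U != finset.set0, W != finset.set0, U :|: W = [set: G], U :&: W = finset.set0 &
      forall x y : G, adj x y ->
        (x \in U /\ y \in W) \/ (x \in W /\ y \in U)].

Definition isomorphic (G H : sgraph) : Prop :=
  exists2 f : G -> H, bijective f & forall x y, adj (f x) (f y) = adj x y.

Definition Kadj (a b : nat) : rel ('I_a + 'I_b) := fun x y =>
  match x, y with
  | inl _, inr _ | inr _, inl _ => true
  | _, _ => false
  end.

Lemma Kadj_sym a b : symmetric (@Kadj a b).
Proof. by case=> ? []. Qed.

Lemma Kadj_irrefl a b : irreflexive (@Kadj a b).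
Proof. by case. Qed.

Definition complete_bipartite (a b : nat) : sgraph :=
  SGraph (@Kadj_sym a b) (@Kadj_irrefl a b).

(* Vertices index rows and columns through the enumeration [enum_val]. *)
Definition Amx (R : realType) (G : sgraph) : 'M[R]_#|G| :=
  \matrix_(i, j) (adj (enum_val i) (enum_val j))%:R.

Definition Dmx (R : realType) (G : sgraph) : 'M[R]_#|G| :=
  diag_mx (\row_i (degree (enum_val i))%:R).

Definition Lmx (R : realType) (G : sgraph) : 'M[R]_#|G| := Dmx R G - Amx R G.

(* At alpha = 1/2 the adjacency part cancels: [Bmx alpha G] is half the degree
   matrix, so its largest eigenvalue only depends on the maximum degree and
   cannot detect completeness (e.g. the path on four vertices). *)
Definition Bmx (R : realType) (alpha : R) (G : sgraph) : 'M[R]_#|G| :=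
  alpha *: Amx R G + (1 - alpha) *: Lmx R G.

(* The spectrum of a real symmetric matrix of positive size is finite and
   non-empty, so this supremum is its largest eigenvalue. *)
Definition lambda1 (R : realType) (n : nat) (S : 'M[R]_n) : R :=
  sup [set x : R | eigenvalue S x]%classic.

Definition falpha (R : realType) (alpha : R) (a b : nat) : R :=
  ((1 - alpha) * (a%:R + b%:R)
   + Num.sqrt ((1 - alpha) ^+ 2 * (a%:R - b%:R) ^+ 2
               + 4 * (2 * alpha - 1) ^+ 2 * a%:R * b%:R)) / 2.

(* Main.v *)
Require Import Defs.
From mathcomp Require Import all_boot all_order all_algebra reals.
From mathcomp Require Import classical_sets boolp ring lra.

Import Order.TTheory GRing.Theory Num.Theory.

Local Open Scope ring_scope.


(** Write gamma = 1 - alpha, beta = 2 alpha - 1 and f = f_alpha(a, b), so that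
B_alpha(G) = gamma D(G) + beta A(G). The number f is the larger root of
(t - gamma a) (t - gamma b) = beta^2 a b ([falpha_root], [falpha_ge_max]).

Let x be an eigenvector for lam. Since every edge joins U to W, the number
(f - lam) |x|^2 = f |x|^2 - x^T B_alpha(G) x can be spread over all the pairs
(u, w) of U x W, by sharing f x_u^2 equally among the b pairs at u and f x_w^2
among the a pairs at w ([sum_slack]). The resulting share of a pair is its
[slack]. At an edge it is the binary form
  P x_u^2 + Q x_w^2 - 2 beta x_u x_w,  P = f/b - gamma,  Q = f/a - gamma,
where P, Q >= 0, and the equation for f says precisely that P Q = beta^2: the
form is degenerate and positive semidefinite. At a non-adjacent pair it is
(f/b) x_u^2 + (f/a) x_w^2 >= 0. Hence lam <= f.

If lam = f, every slack vanishes. When beta <> 0, a zero slack at an edge forces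
x_u and x_w to vanish together, and at a non-adjacent pair it forces both to be
zero. As both classes are non-empty and x <> 0, no entry of x is zero, so no
pair of U x W is non-adjacent and G is complete bipartite
([complete_of_eigenvalue_falpha]). Conversely, on K_{a,b} the vectors that are
constant on each class reduce the eigenvalue equation for f to a singular 2 x 2
system ([falpha_eigenvalue]).

As the largest eigenvalue is defined as a supremum, these facts about
eigenvalues are transferred to it by [lambda1_eigenvalue]: if there is an
eigenvalue at all, the supremum is one. *)

(** * The number f_alpha(a, b) *)

Section FAlpha.
Variables (R : realType) (alpha : R) (a b : nat).
Hypothesis alpha01 : 0 <= alpha <= 1.
Let f := falpha alpha a b.

(** The defining formula solves the quadratic equation
(t - gamma b) (t - gamma a) = beta^2 a b, whose discriminant is under the root. *)
Lemma falpha_root :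
  (f - (1 - alpha) * b%:R) * (f - (1 - alpha) * a%:R)
  = (2 * alpha - 1) ^+ 2 * (a%:R * b%:R).
Proof.
rewrite /f /falpha; set D := (X in Num.sqrt X).
have D0 : 0 <= D.
  by rewrite /D addr_ge0 ?(sqr_ge0, ler0n, mulr_ge0).
have := sqr_sqrtr D0; set s := Num.sqrt D => sD.
transitivity ((s ^+ 2 - (1 - alpha) ^+ 2 * (a%:R - b%:R) ^+ 2) / 4); first by field.
by rewrite sD /D; field.
Qed.

(** The square root is at least gamma |a - b|, so [falpha] is the larger root. *)
Lemma falpha_ge_max :
  (1 - alpha) * b%:R <= f /\ (1 - alpha) * a%:R <= f.
Proof.
have [a0 a1] := andP alpha01.
rewrite /f /falpha; set D := (X in Num.sqrt X).
suff : (1 - alpha) * `|a%:R - b%:R| <= Num.sqrt D.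
  have := ler_norm (a%:R - b%:R : R); have := ler_norm (b%:R - a%:R : R).
  rewrite distrC => h1 h2 h3; have g0 : 0 <= 1 - alpha by lra.
  have := ler_wpM2l g0 h1; have := ler_wpM2l g0 h2.
  by split; lra.
rewrite -[leLHS]ger0_norm ?mulr_ge0 ?subr_ge0// -sqrtr_sqr ler_wsqrtr//.
by rewrite exprMn real_normK ?num_real// /D lerDl ?(sqr_ge0, ler0n, mulr_ge0).
Qed.

End FAlpha.

(** * Degenerate binary quadratic forms *)

Section BinaryForm.
Variables (R : realType) (P Q c : R).
Hypotheses (P0 : 0 <= P) (Q0 : 0 <= Q) (PQ : P * Q = c ^+ 2).

(** Multiplying by P completes the square: P times the form is
(P x - c y)^2. *)
Lemma binary_form_ge0 x y : 0 <= P * x ^+ 2 + Q * y ^+ 2 - 2 * c * x * y.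
Proof.
have [Pz|Pn] := eqVneq P 0.
  have c0 : c = 0 by apply/eqP; rewrite -sqrf_eq0 -PQ Pz mul0r.
  by rewrite Pz c0 !(mul0r, mulr0) add0r subr0 mulr_ge0 ?sqr_ge0.
have Pp : 0 < P by rewrite lt_def Pn.
rewrite -(pmulr_rge0 _ Pp).
suff -> : P * (P * x ^+ 2 + Q * y ^+ 2 - 2 * c * x * y) = (P * x - c * y) ^+ 2.
  exact: sqr_ge0.
by rewrite !mulrBr mulrDr [P * (Q * _)]mulrA PQ; ring.
Qed.

(** Since c is non-zero so are P and Q, hence the isotropic line P x = c y is
neither of the coordinate axes. *)
Lemma binary_form_isotropic x y : c != 0 ->
  P * x ^+ 2 + Q * y ^+ 2 - 2 * c * x * y = 0 -> (x == 0) = (y == 0).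
Proof.
move=> c0 e.
have : P * Q != 0 by rewrite PQ sqrf_eq0.
rewrite mulf_eq0 negb_or => /andP[Pn Qn].
apply/eqP/eqP => z; move: e; rewrite z ?(expr0n, mulr0, mul0r, subr0, addr0, add0r) /=.
- by move/eqP; rewrite mulf_eq0 (negbTE Qn) /= sqrf_eq0 => /eqP.
- by move/eqP; rewrite mulf_eq0 (negbTE Pn) /= sqrf_eq0 => /eqP.
Qed.

End BinaryForm.

(** * The largest eigenvalue *)

(** Splitting off the known root x0 leaves a polynomial of smaller degree; the
larger of x0 and the largest root of the quotient, if there is one, works. *)
Lemma max_root (R : realType) (p : {poly R}) x0 : p != 0 -> root p x0 ->
  exists2 m, root p m & forall x, root p x -> x <= m.
Proof.
have [n] := ubnP (size p); elim: n p x0 => // n IH p x0 sp p0 rx.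
have /factor_theorem[q pq] := rx.
have q0 : q != 0 by apply: contraNneq p0 => z; rewrite pq z mul0r.
have rP x : root p x = root q x || (x == x0).
  by rewrite pq rootM root_XsubC.
have [[y ry]|nr] := pselect (exists y, root q y); last first.
  exists x0 => // x; rewrite rP => /orP[rq|/eqP->//].
  by case: nr; exists x.
have [|m rm mx] := IH q y _ q0 ry.
  by move: sp; rewrite pq size_mul ?polyXsubC_eq0// size_XsubC addn2 ltnS.
exists (Num.max x0 m).
  by rewrite rP; case: leP => _; rewrite ?rm ?eqxx ?orbT.
by move=> x; rewrite rP le_max => /orP[/mx->|/eqP->]; rewrite ?orbT ?lexx.
Qed.

(** The eigenvalues are the roots of the characteristic polynomial, so their
supremum is a maximum. *)
Lemma lambda1_eigenvalue (R : realType) n (S : 'M[R]_n) :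
  (exists x, eigenvalue S x) -> eigenvalue S (lambda1 S).
Proof.
case=> x0 ex0.
have cp0 : char_poly S != 0 by rewrite monic_neq0 ?char_poly_monic.
have [|m rm mx] := @max_root _ (char_poly S) x0 cp0.
  by rewrite -eigenvalue_root_char.
suff -> : lambda1 S = m by rewrite eigenvalue_root_char.
have um : ubound [set x : R | eigenvalue S x]%classic m.
  by move=> x /=; rewrite eigenvalue_root_char => /mx.
apply/eqP; rewrite eq_le; apply/andP; split.
  by apply: ge_sup => //; exists x0.
apply: ub_le_sup; first by exists m.
by rewrite /= eigenvalue_root_char.
Qed.

(** The eigenvalue equation written at each vertex, with vectors indexed by the
vertices themselves. Collecting the degree term neighbour by neighbour puts
both parts of the matrix under one sum over edges. *)
Lemma eigenvalue_BmxP (R : realType) (alpha : R) (G : sgraph) lam :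
  eigenvalue (Bmx alpha G) lam <->
  exists2 x : G -> R, exists g, x g != 0 &
    forall g, \sum_h (adj g h)%:R *
      ((1 - alpha) * x g + (2 * alpha - 1) * x h) = lam * x g.
Proof.
have key (v : 'rV[R]_#|G|) (x : G -> R) j : (forall i, v 0 i = x (enum_val i)) ->
    (v *m Bmx alpha G) 0 j =
    \sum_h (adj (enum_val j) h)%:R *
      ((1 - alpha) * x (enum_val j) + (2 * alpha - 1) * x h).
  move=> vx; rewrite /Bmx /Lmx scalerBr addrCA -scalerBl -/(Dmx R G).
  rewrite mulmxDr -!scalemxAr mxE [X in X + _]mxE [X in _ + X]mxE /Dmx mul_mx_diag !mxE.
  under [RHS]eq_bigr do rewrite mulrDr.
  rewrite big_split /=; congr (_ + _).
    rewrite -mulr_suml vx [X in _ * X = _]mulrC mulrCA; congr (_ * _).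
    rewrite /degree -sum1_card natr_sum [in RHS](bigID (fun h => adj (enum_val j) h)) /=.
    rewrite [X in _ = _ + X]big1 ?addr0; last by move=> i /negbTE ->.
    by apply: eq_big => [h|h]; rewrite ?inE// => ->.
  rewrite mulr_sumr (reindex (@enum_val G G)) /=; last first.
    by apply: onW_bij; exact: enum_val_bij.
  apply: eq_bigr => i _; rewrite vx mxE adj_sym.
  ring.
split.
  case/eigenvalueP => v vB v0.
  exists (fun g => v 0 (enum_rank g)).
    case/rV0Pn: v0 => i vi; exists (enum_val i).
    by rewrite enum_valK.
  move=> g; have := key v (fun g => v 0 (enum_rank g)) (enum_rank g).
  rewrite enum_rankK vB mxE => <- // i.
  by rewrite enum_valK.
case=> x [g xg] xB; apply/eigenvalueP; exists (\row_i x (enum_val i)).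
  apply/rowP => j; rewrite (key _ x); first by rewrite xB !mxE.
  by move=> i; rewrite mxE.
by apply/rV0Pn; exists (enum_rank g); rewrite mxE enum_rankK.
Qed.

(** * The quadratic form as a sum over pairs of opposite vertices *)

Section Bipartite.
Variables (R : realType) (G : sgraph) (U W : {set G}) (alpha : R).
Hypotheses (bipG : bipartition U W) (alpha01 : 0 <= alpha <= 1).
Let a := #|U|.
Let b := #|W|.
Let f := falpha alpha a b.

(** The share of the pair (u, w) in f |x|^2 - x^T B x. *)
Definition slack (x : G -> R) (u w : G) : R :=
  f / b%:R * x u ^+ 2 + f / a%:R * x w ^+ 2 - (adj u w)%:R *
    ((1 - alpha) * (x u ^+ 2 + x w ^+ 2) + 2 * (2 * alpha - 1) * x u * x w).

Lemma class_card_gt0 : 0 < a%:R :> R /\ 0 < b%:R :> R.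
Proof. by case: bipG => U0 W0 _ _ _; rewrite !ltr0n !card_gt0. Qed.

Lemma in_classW g : (g \in W) = (g \notin U).
Proof.
case: bipG => _ _ UW dUW _.
have : g \in U :|: W by rewrite UW inE.
have : g \notin U :&: W by rewrite dUW inE.
by rewrite !inE; do 2 case: (_ \in _).
Qed.

Lemma adj_classes g h : adj g h -> (g \in U) = (h \in W).
Proof.
case: bipG => _ _ _ _ H /H.
by rewrite !in_classW => -[[-> ->]|[/negbTE-> ->]].
Qed.

Lemma sum_classes (F : G -> R) :
  \sum_g F g = \sum_(u in U) F u + \sum_(w in W) F w.
Proof.
rewrite (bigID (mem U)) /=; congr (_ + _).
by apply: eq_bigl => g; rewrite in_classW.
Qed.

(** The equation at g, multiplied by x g and summed over g, counts each edge
once from each end; regrouping by edges gives the quadratic form. *)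
Lemma sum_slack (lam : R) (x : G -> R) :
    (forall g, \sum_h (adj g h)%:R *
      ((1 - alpha) * x g + (2 * alpha - 1) * x h) = lam * x g) ->
  \sum_(u in U) \sum_(w in W) slack x u w = (f - lam) * \sum_g x g ^+ 2.
Proof.
move=> eqx; have [a0 b0] := class_card_gt0.
rewrite /slack.
under eq_bigr do rewrite sumrB big_split /=.
rewrite sumrB big_split /=.
have -> : \sum_(u in U) \sum_(w in W) f / b%:R * x u ^+ 2 = f * \sum_(u in U) x u ^+ 2.
  rewrite mulr_sumr; apply: eq_bigr => u _.
  by rewrite sumr_const -/b -[LHS]mulr_natr; field; rewrite gt_eqF.
have -> : \sum_(u in U) \sum_(w in W) f / a%:R * x w ^+ 2 = f * \sum_(w in W) x w ^+ 2.
  rewrite exchange_big mulr_sumr; apply: eq_bigr => w _.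
  by rewrite sumr_const -/a -[LHS]mulr_natr; field; rewrite gt_eqF.
rewrite -mulrDr -sum_classes mulrBl; congr (_ - _).
rewrite mulr_sumr [RHS](eq_bigr (fun g => \sum_h (adj g h)%:R *
      ((1 - alpha) * x g + (2 * alpha - 1) * x h) * x g)); last first.
  by move=> g _; rewrite -mulr_suml eqx; ring.
rewrite [RHS]sum_classes.
(* Only the class opposite to g contributes to the sum over all vertices. *)
have supp (B : {set G}) (F : G -> R) g :
    (forall h, adj g h -> h \in B) ->
    \sum_h (adj g h)%:R * F h * x g = \sum_(h in B) (adj g h)%:R * F h * x g.
  move=> gB; rewrite [RHS]big_mkcond; apply: eq_bigr => h _.
  case: ifPn => // hB; case: (boolP (adj g h)) => [/gB|]; first by rewrite (negbTE hB).
  by rewrite !mul0r.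
rewrite [X in _ = X + _](eq_bigr (fun u => \sum_(w in W) (adj u w)%:R *
      ((1 - alpha) * x u + (2 * alpha - 1) * x w) * x u)); last first.
  by move=> u uU; rewrite (supp W)// => h /adj_classes <-.
rewrite [X in _ = _ + X](eq_bigr (fun w => \sum_(u in U) (adj w u)%:R *
      ((1 - alpha) * x w + (2 * alpha - 1) * x u) * x w)); last first.
  by move=> w wW; rewrite (supp U)// => h; rewrite adj_sym => /adj_classes ->.
rewrite [X in _ = _ + X]exchange_big -big_split /=.
apply: eq_bigr => u _; rewrite -big_split /=; apply: eq_bigr => w _.
by rewrite (adj_sym w u); ring.
Qed.

(** The coefficients of the slack at an edge; their product is the equation
of [falpha_root] divided by a b. *)
Lemma edge_weights :
  [/\ 0 <= f / b%:R - (1 - alpha), 0 <= f / a%:R - (1 - alpha) &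
  (f / b%:R - (1 - alpha)) * (f / a%:R - (1 - alpha)) = (2 * alpha - 1) ^+ 2].
Proof.
have [a0 b0] := class_card_gt0.
have [fb fa] := falpha_ge_max _ alpha a b alpha01.
rewrite !subr_ge0 (ler_pdivlMr _ _ b0) (ler_pdivlMr _ _ a0); split=> //.
have := falpha_root _ alpha a b; rewrite -/f => e.
have ab0 : a%:R * b%:R != 0 :> R by rewrite mulf_neq0 ?gt_eqF.
apply: (mulIf ab0); rewrite -e; field.
by rewrite !gt_eqF.
Qed.

Lemma slack_adj x u w : adj u w -> slack x u w =
  (f / b%:R - (1 - alpha)) * x u ^+ 2 + (f / a%:R - (1 - alpha)) * x w ^+ 2
  - 2 * (2 * alpha - 1) * x u * x w.
Proof. by rewrite /slack => ->; rewrite mul1r; ring. Qed.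

Lemma slack_nadj x u w : ~~ adj u w ->
  slack x u w = f / b%:R * x u ^+ 2 + f / a%:R * x w ^+ 2.
Proof. by rewrite /slack => /negbTE ->; rewrite mul0r subr0. Qed.

Lemma falpha_ge0 : 0 <= f.
Proof.
have [a0 a1] := andP alpha01.
apply: le_trans (proj1 (falpha_ge_max _ alpha a b alpha01)).
by rewrite mulr_ge0 ?subr_ge0.
Qed.

(** If f = 0 then gamma = 0, so alpha = 1, and then the product in
[edge_weights] would be 0 = 1. *)
Lemma falpha_gt0 : 0 < f.
Proof.
rewrite lt_def falpha_ge0 andbT; apply/eqP => f0.
have [P0 Q0 PQ] := edge_weights; have [al0 al1] := andP alpha01.
move: P0 PQ; rewrite f0 !mul0r !sub0r oppr_ge0 => al1'.
have -> : alpha = 1 by apply/eqP; rewrite eq_le al1 -subr_le0.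
by rewrite subrr oppr0 mul0r => e; lra.
Qed.

Lemma slack_ge0 x u w : 0 <= slack x u w.
Proof.
have [P0 Q0 PQ] := edge_weights.
case: (boolP (adj u w)) => [/slack_adj->|/slack_nadj->].
  exact: binary_form_ge0.
by rewrite addr_ge0// mulr_ge0 ?sqr_ge0// divr_ge0 ?falpha_ge0.
Qed.

Lemma slack_eq0 x u w : alpha != 2^-1 -> slack x u w = 0 ->
  (x u == 0) = (x w == 0) /\ (~~ adj u w -> x u = 0).
Proof.
move=> an; have [P0 Q0 PQ] := edge_weights; have [a0 b0] := class_card_gt0.
case: (boolP (adj u w)) => [/slack_adj->|/slack_nadj->].
  move=> e; split=> //; apply: binary_form_isotropic e => //.
  by apply: contra an => /eqP e; apply/eqP; lra.
have fb : 0 < f / b%:R by rewrite divr_gt0 ?falpha_gt0.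
have fa : 0 < f / a%:R by rewrite divr_gt0 ?falpha_gt0.
move/eqP; rewrite (paddr_eq0 (mulr_ge0 (ltW fb) (sqr_ge0 _))
                             (mulr_ge0 (ltW fa) (sqr_ge0 _))).
rewrite (mulf_eq0 (f / b%:R)) (mulf_eq0 (f / a%:R)) (gt_eqF fa) (gt_eqF fb) /= !sqrf_eq0.
by move=> /andP[/eqP-> /eqP->].
Qed.

Lemma sum_sqr_gt0 (x : G -> R) g : x g != 0 -> 0 < \sum_g x g ^+ 2.
Proof.
move=> xg; rewrite (bigD1 g) //= ltr_wpDr ?sumr_ge0// => [i _|].
  exact: sqr_ge0.
by rewrite exprn_even_gt0.
Qed.

Lemma eigenvalue_le_falpha lam : eigenvalue (Bmx alpha G) lam -> lam <= f.
Proof.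
case/eigenvalue_BmxP => x [g xg] /sum_slack e.
rewrite -subr_ge0 -(pmulr_lge0 _ (sum_sqr_gt0 _ _ xg)) -e.
by apply: sumr_ge0 => u _; apply: sumr_ge0 => w _; exact: slack_ge0.
Qed.

(** * The bound and its equality case *)

Lemma lambda1_le_falpha : lambda1 (Bmx alpha G) <= f.
Proof.
have [[x ex]|n] := pselect (exists x, eigenvalue (Bmx alpha G) x).
  by apply: eigenvalue_le_falpha; apply: lambda1_eigenvalue; exists x.
rewrite /lambda1 (_ : [set x | _]%classic = set0) ?sup0 ?falpha_ge0//.
by apply/seteqP; split=> // x /= ex; case: n; exists x.
Qed.

(** Zero entries would propagate from one class to the whole other class and
back, making the eigenvector zero; and a non-adjacent pair has zero entries. *)
Lemma complete_of_eigenvalue_falpha : alpha != 2^-1 ->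
  eigenvalue (Bmx alpha G) f -> {in U & W, forall u w, adj u w}.
Proof.
move=> an /eigenvalue_BmxP[x [g xg]] /sum_slack; rewrite subrr mul0r => e.
have sl0 u w : u \in U -> w \in W -> slack x u w = 0.
  move=> uU wW; move: e => /eqP; rewrite psumr_eq0; last first.
    by move=> ? _; apply: sumr_ge0 => ? _; exact: slack_ge0.
  move=> /allP /(_ u); rewrite mem_index_enum uU => /(_ isT) /=.
  rewrite psumr_eq0; last by move=> ? _; exact: slack_ge0.
  by move=> /allP /(_ w); rewrite mem_index_enum wW => /(_ isT) /= /eqP.
have nz u w (uU : u \in U) (wW : w \in W) := slack_eq0 x u w an (sl0 u w uU wW).
have xU u : u \in U -> x u != 0.
  move=> uU; case: (boolP (g \in U)) => gU; last first.
    by rewrite (proj1 (nz u g _ _)) ?in_classW.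
  have [w wW] : exists w, w \in W by case: bipG => _ /set0Pn.
  by rewrite (proj1 (nz u w _ _))// -(proj1 (nz g w _ _)).
move=> u w uU wW; apply: contraT => /(proj2 (nz u w uU wW)) /eqP.
by rewrite (negbTE (xU u uU)).
Qed.

(** The isomorphism is the inverse of the map that enumerates each class. *)
Lemma isomorphic_complete_bipartite : {in U & W, forall u w, adj u w} ->
  isomorphic G (complete_bipartite a b).
Proof.
move=> cG.
pose g (z : complete_bipartite a b) : G :=
  match z with inl i => enum_val i | inr j => enum_val j end.
have gU z : (g z \in U) = if z is inl _ then true else false.
  case: z => i /=; first exact: enum_valP.
  by apply/negbTE; rewrite -in_classW; exact: enum_valP.
have g_inj : injective g.
  move=> y z e; have := gU y; rewrite e gU.
  by case: y z e => [i|i] [j|j] //= /enum_val_inj ->.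
have cardG : #|G| = #|complete_bipartite a b|.
  rewrite card_sum !card_ord -(cardsC U); congr (_ + _)%N.
  by apply: eq_card => h; rewrite in_classW inE.
have [h gh hg] : bijective g by apply: inj_card_bij; rewrite // cardG.
exists h; first by exists g.
move=> x y; rewrite -[x in RHS]hg -[y in RHS]hg.
case: (h x) (h y) => [i|i] [j|j] /=; apply/esym.
- by apply/negP => /adj_classes; rewrite in_classW !enum_valP.
- by apply: cG; exact: enum_valP.
- by rewrite adj_sym; apply: cG; exact: enum_valP.
- apply/negP => /adj_classes; rewrite enum_valP.
  by move=> /esym; have := enum_valP i; rewrite in_classW => /negbTE->.
Qed.

End Bipartite.

(** The vector equal to s on the first class and t on the second one is an
eigenvector for f when (f - gamma b) s = beta b t and (f - gamma a) t =
beta a s. By [falpha_root] one solution is s = beta b, t = f - gamma b. *)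
Lemma falpha_eigenvalue (R : realType) (G : sgraph) (a b : nat) (alpha : R) :
    (0 < a)%N -> (0 < b)%N ->
  isomorphic G (complete_bipartite a b) ->
  eigenvalue (Bmx alpha G) (falpha alpha a b).
Proof.
move=> a0 b0 [h [k hk kh] hadj].
set f := falpha alpha a b.
pose c := 2 * alpha - 1.
have key (s t : R) : (s != 0) || (t != 0) ->
   (f - (1 - alpha) * b%:R) * s = c * b%:R * t ->
   (f - (1 - alpha) * a%:R) * t = c * a%:R * s ->
   eigenvalue (Bmx alpha G) f.
  move=> st e1 e2; apply/eigenvalue_BmxP.
  exists (fun g => if h g is inl _ then s else t).
    case/orP: st => [s0|t0].
      by exists (k (inl (Ordinal a0))); rewrite kh.
    by exists (k (inr (Ordinal b0))); rewrite kh.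
  move=> g; under eq_bigr do rewrite -hadj.
  rewrite (reindex k) /=; last by apply: onW_bij; exists h.
  under eq_bigr do rewrite kh.
  rewrite big_sumType /=; case: (h g) => i /=.
    rewrite big1 ?add0r => [|j _]; last by rewrite mul0r.
    rewrite sumr_const card_ord -[LHS]mulr_natr.
    have -> : f * s = (f - (1 - alpha) * b%:R) * s + (1 - alpha) * b%:R * s by ring.
    by rewrite e1 /c; ring.
  rewrite [X in _ + X]big1 ?addr0 => [|j _]; last by rewrite mul0r.
  rewrite sumr_const card_ord -[LHS]mulr_natr.
  have -> : f * t = (f - (1 - alpha) * a%:R) * t + (1 - alpha) * a%:R * t by ring.
  by rewrite e2 /c; ring.
have [st|] := boolP ((c * b%:R != 0) || (f - (1 - alpha) * b%:R != 0)).
  apply: (key _ _ st); first by rewrite mulrC.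
  by rewrite mulrC falpha_root /c; ring.
(* Here beta = 0 and f = gamma b, so that solution is the zero vector; then any
   vector supported on the first class works. *)
rewrite negb_or !negbK mulf_eq0 pnatr_eq0 (gtn_eqF b0) orbF => /andP[/eqP c0 /eqP f0].
apply: (key 1 0); first by rewrite oner_eq0.
  by rewrite f0 mul0r mulr0.
by rewrite c0 !(mul0r, mulr0).
Qed.

Theorem theorem4p5 (R : realType) (G : sgraph) (U W : {set G}) (a b : nat)
    (alpha : R) (connG : connected G) (bipG : bipartition U W)
    (cardU : #|U| = a) (cardW : #|W| = b) (alpha01 : 0 <= alpha <= 1) :
  [/\ lambda1 (Bmx alpha G) <= falpha alpha a b,
      isomorphic G (complete_bipartite a b) ->
        lambda1 (Bmx alpha G) = falpha alpha a b &
      alpha != 2^-1 ->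
        lambda1 (Bmx alpha G) = falpha alpha a b ->
        isomorphic G (complete_bipartite a b)].
Proof.
have [a0 b0] : (0 < a)%N /\ (0 < b)%N.
  by rewrite -cardU -cardW !card_gt0; case: bipG.
have le_f := lambda1_le_falpha R G U W alpha bipG alpha01.
have ev_le := eigenvalue_le_falpha R G U W alpha bipG alpha01.
have f_gt0 := falpha_gt0 R G U W alpha bipG alpha01.
have compl := complete_of_eigenvalue_falpha R G U W alpha bipG alpha01.
have iso := isomorphic_complete_bipartite G U W bipG.
rewrite cardU cardW in le_f ev_le f_gt0 compl iso.
split=> //.
  move=> /(falpha_eigenvalue R G a b alpha a0 b0) ef.
  apply/eqP; rewrite eq_le le_f /=.
  by apply: ub_le_sup => //; exists (falpha alpha a b) => x /= /ev_le.
move=> an lf; apply/iso/compl => //.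
(* Without eigenvalues the supremum would be 0, but it equals f > 0. *)
rewrite -lf; apply: lambda1_eigenvalue; apply: contrapT => n.
have := f_gt0; rewrite -lf /lambda1 (_ : [set x | _]%classic = set0).
  by rewrite sup0 ltxx.
by apply/seteqP; split=> // x /= ex; case: n; exists x.
Qed.
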